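(* Let $K$ be a field, $a,b\in\mathbb{Z}_{\ge 0}$, $\ell=a+b$. Let $x_0,\dots,x_k\in K$ be distinct, let $a_0,\dots,a_k$ be positive integers with $a_0+\cdots+a_k=\ell+1$, and let $y_{i,j}\in K$ for $0\le i\le k$, $0\le j<a_i$. Let $f=\prod_{i=0}^k(x-x_i)^{a_i}$ and let $g\in K[x]$ be the Hermite interpolation polynomial of degree at most $\ell$ associated to these data. For $0\le d\le \ell$ let $\operatorname{Sres}_d(f,g)$ and $G_d$ be the polynomials defined in the context. Let $0\le d\le a$ be the maximal index such that $\operatorname{Sres}_d(f,g)\ne 0$ (assuming that such an index exists). Then $\deg(G_d)\le b$, and the osculatory rational interpolation problem for these data has a solution if and only if $G_d(x_i)\ne 0$ for all $0\le i\le k$. In that case the solution is given by the pair $(\operatorname{Sres}_d(f,g),G_d)$, that is, $$\frac{A}{B}=\frac{\operatorname{Sres}_d(f,g)}{G_d}$$ as rational functions, where moreover $\gcd\big(\operatorname{Sres}_d(f,g),G_d\big)=1$.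
   Context: **Osculatory rational interpolation problem.** Given the data, find polynomials $A,B\in K[x]$ with $\deg A\le a$, $\deg B\le b$, $B(x_i)\neq 0$ for all $i$ with $a_i\ge 1$, such that $(A/B)^{(j)}(x_i)=j!\,y_{i,j}$ for $0\le i\le k$, $0\le j<a_i$, understood as: the coefficient of $(x-x_i)^j$ in the Taylor expansion of $A/B$ at $x_i$ equals $y_{i,j}$. Such a pair (or the quotient $A/B$) is called a solution. The zero polynomial satisfies every degree bound. **Hermite interpolation polynomial.** $g=\sum_{i=0}^{\ell}g_ix^i$ is the unique polynomial of degree at most $\ell$ such that the coefficient of $(x-x_i)^j$ in the Taylor expansion of $g$ at $x_i$ is $y_{i,j}$ for $0\le i\le k$, $0\le j<a_i$ (that is, $g^{(j)}(x_i)=j!\,y_{i,j}$). Here $g_i=0$ for $\deg(g)<i\le\ell$. **Subresultants.** Write $f=\sum_{i=0}^{\ell+1}f_ix^i$ (so $f_{\ell+1}=1$), and set $f_i=0$ for $i\notin\{0,\dots,\ell+1\}$ and $g_i=0$ for $i\notin\{0,\dots,\ell\}$. For $0\le d\le\ell$, $\operatorname{Sres}_d(f,g)\in K[x]$ is the determinant of the $(2\ell+1-2d)\times(2\ell+1-2d)$ matrix whose rows are: - for $r=1,\dots,\ell-d$, the $r$-th row has entry $f_{\ell+1-(c-r)}$ in column $c$ for $1\le c\le 2\ell-2d$, and entry $x^{\ell-d-r}f(x)$ in the last column; - for $s=1,\dots,\ell-d+1$, the $(\ell-d+s)$-th row has entry $g_{\ell-(c-s)}$ in column $c$ for $1\le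 c\le 2\ell-2d$, and entry $x^{\ell-d+1-s}g(x)$ in the last column. (In particular $\operatorname{Sres}_\ell(f,g)=g$.) $G_d\in K[x]$ is the determinant of the matrix obtained from this one by replacing the last column by the column whose first $\ell-d$ entries are $0$ and whose last $\ell-d+1$ entries are $x^{\ell-d},x^{\ell-d-1},\dots,x,1$ (in this order). *)

(* Defs.v *)
From mathcomp Require Import all_boot all_order all_algebra.

Set Implicit Arguments.
Unset Strict Implicit.
Unset Printing Implicit Defensive.

Import GRing.Theory.
Local Open Scope ring_scope.

Section Taylor.

Variable K : fieldType.
Implicit Types (A B p : {poly K}) (c : K).

(* The coefficient of (x - c)^j in p; unlike p^`(j).[c] / j`!, it is the right
   notion in every characteristic. *)
Definition taylor_coef p c (j : nat) : K := (p \Po ('X + c%:P))`_j.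

(* The first n coefficients of the power series A / B at c, by long division
   in K[[x - c]]; meaningful when B.[c] != 0. *)
Fixpoint taylor_quot_seq A B c (n : nat) : seq K :=
  if n is m.+1 then
    let u := taylor_quot_seq A B c m in
    rcons u ((taylor_coef A c m - \sum_(i < m) u`_i * taylor_coef B c (m - i))
             / taylor_coef B c 0)
  else [::].

Definition taylor_quot A B c (j : nat) : K := (taylor_quot_seq A B c j.+1)`_j.

Lemma taylor_coef0 p c : taylor_coef p c 0 = p.[c].
Proof.
by rewrite /taylor_coef -horner_coef0 horner_comp hornerD hornerX hornerC add0r.
Qed.

Lemma size_taylor_quot_seq A B c n : size (taylor_quot_seq A B c n) = n.
Proof. by elim: n => //= n IHn; rewrite size_rcons IHn. Qed.

Lemma nth_taylor_quot_seq A B c n j :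
  (j < n)%N -> (taylor_quot_seq A B c n)`_j = taylor_quot A B c j.
Proof.
elim: n => // n IHn; rewrite ltnS leq_eqVlt => /predU1P[->//|ltjn].
by rewrite /= nth_rcons size_taylor_quot_seq ltjn IHn.
Qed.

Lemma taylor_quot_rec A B c n :
  taylor_quot A B c n =
  (taylor_coef A c n
   - \sum_(i < n) taylor_quot A B c i * taylor_coef B c (n - i)) / B.[c].
Proof.
rewrite {1}/taylor_quot /= nth_rcons size_taylor_quot_seq ltnn eqxx.
rewrite taylor_coef0; congr ((_ - _) / _).
by apply: eq_bigr => i _; rewrite nth_taylor_quot_seq.
Qed.

(* taylor_quot A B c is the only power series u with u * B = A at c. *)
Lemma taylor_quotP A B c (u : nat -> K) : B.[c] != 0 ->
  (forall n, \sum_(i < n.+1) u i * taylor_coef B c (n - i) = taylor_coef A c n)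
  <-> (forall n, u n = taylor_quot A B c n).
Proof.
move=> Bc0; split=> Hu n.
  elim/ltn_ind: n => n IHn; rewrite taylor_quot_rec -Hu big_ord_recr /= subnn.
  rewrite taylor_coef0 (eq_bigr (fun i : 'I_n =>
    taylor_quot A B c i * taylor_coef B c (n - i))) => [|i _].
    by rewrite addrC addrK mulfK.
  by rewrite IHn.
rewrite big_ord_recr /= subnn taylor_coef0 Hu taylor_quot_rec divfK //.
rewrite (eq_bigr (fun i : 'I_n =>
  taylor_quot A B c i * taylor_coef B c (n - i))) => [|i _]; last by rewrite Hu.
by rewrite addrC subrK.
Qed.

End Taylor.

Section Interpolation.

Variables (K : fieldType) (k : nat).
Variables (x : 'I_k.+1 -> K) (m : 'I_k.+1 -> nat) (y : 'I_k.+1 -> nat -> K).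

(* The data are the nodes x i, the multiplicities m i (written a_i in the
   mathematics, where a is also a degree bound) and the values y i j, of which
   only those with j < m i matter. *)

Definition is_hermite_interp (l : nat) (g : {poly K}) : Prop :=
  (size g <= l.+1)%N /\
  (forall i j, (j < m i)%N -> taylor_coef g (x i) j = y i j).

Definition is_osculatory_solution (a b : nat) (A B : {poly K}) : Prop :=
  [/\ (size A <= a.+1)%N,
      (size B <= b.+1)%N,
      (forall i, (0 < m i)%N -> B.[x i] != 0)
    & (forall i j, (j < m i)%N -> taylor_quot A B (x i) j = y i j)].

End Interpolation.

Section Subresultants.

Variable K : fieldType.
Implicit Types f g : {poly K}.

(* Coefficients with an integer index, zero at negative indices: truncated
   subtraction on nat would wrongly return the constant coefficient. *)
Definition coefz f (i : int) : K := if i is Posz n then f`_n else 0.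

(* The degrees of f and g are taken formally to be l + 1 and l. The rows and
   columns are numbered from 1, and u r, v s are the entries of the last column
   in the r-th f-row and in the s-th g-row. *)
Definition subres_mx (l : nat) f g (d : nat) (u v : nat -> {poly K}) :
    'M[{poly K}]_((l - d).*2.+1) :=
  \matrix_(i, j)
    let n := (l - d)%N in
    let c := j.+1 in
    let r := i.+1 in
    let s := (i.+1 - n)%N in
    if (r <= n)%N then
      if (c <= n.*2)%N then (coefz f (l.+1%:Z - (c%:Z - r%:Z)))%:P else u r
    else
      if (c <= n.*2)%N then (coefz g (l%:Z - (c%:Z - s%:Z)))%:P else v s.

Definition Sres (l : nat) f g (d : nat) : {poly K} :=
  \det (subres_mx l f g d
          (fun r => 'X^(l - d - r) * f) (fun s => 'X^(l - d + 1 - s) * g)).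

Definition Gres (l : nat) f g (d : nat) : {poly K} :=
  \det (subres_mx l f g d (fun=> 0) (fun s => 'X^(l - d + 1 - s))).

End Subresultants.

(* Main.v *)
(* Consider the pairs (R, T) with R = T g mod f, deg R <= e, deg T <= l - e.
   They form the left kernel of the constant columns of the matrix of Sres_e,
   and (Sres_e, G_e) comes from the vector of their signed maximal minors. So
   if Sres_e != 0 then all such pairs are scalar multiples of (Sres_e, G_e),
   and if the coefficient of degree e of Sres_e is 0 then there is a nonzero
   pair with deg R < e. Starting from a nonzero pair with deg R <= a, deg T
   <= b, the vanishing of Sres_e for d < e <= a brings deg R down to d
   without raising deg T above b; by uniqueness the pair obtained is (Sres_d,
   G_d) up to a scalar, which bounds deg G_d. A solution A / B is a pair
   whose B vanishes at no node, and it satisfies A G_d = Sres_d B since both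
   pairs are proportional mod f and the degrees are small. Dividing (Sres_d,
   G_d) by its gcd then gives a pair again, so by uniqueness the gcd is
   constant, and G_d divides B. *)

Require Import Defs.
From mathcomp Require Import all_boot all_order all_algebra.
From mathcomp Require Import zify ring.

Set Implicit Arguments.
Unset Strict Implicit.
Unset Printing Implicit Defensive.

Import GRing.Theory.
Local Open Scope ring_scope.

(** * Subresultants as combinations of rows *)

Section SubresultantCombinations.

Variables (K : fieldType) (l : nat) (f g : {poly K}) (e : nat).
Hypotheses (f_monic : f \is monic) (size_f : size f = l.+2).
Hypotheses (size_g : (size g <= l.+1)%N) (le_el : (e <= l)%N).

Local Notation n := (l - e)%N.
Local Notation N := n.*2.+1.

(* Rows are numbered from 0 here: the i-th row of subres_mx lists coefficients
   of row_poly i; the f-row r is i = r - 1 and the g-row s is i = n + s - 1. *)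
Definition row_cofactor_f (i : nat) : {poly K} :=
  if (i < n)%N then 'X^(n - i.+1) else 0.

Definition row_cofactor_g (i : nat) : {poly K} :=
  if (i < n)%N then 0 else 'X^(n.*2 - i).

Definition row_poly (i : nat) : {poly K} :=
  row_cofactor_f i * f + row_cofactor_g i * g.

(** The columns are the degrees from 2l - e down to e. The last one, of degree e, stands in for the
    polynomial column of [subres_mx] and keeps the matrix over [K]. *)
Definition subres_coef_mx : 'M[K]_N :=
  \matrix_(i, j) (row_poly i)`_(l.*2 - e - j).

Definition subres_minor (i : 'I_N) : K := cofactor subres_coef_mx i ord_max.

Definition comb_f (v : 'I_N -> K) := \sum_(i < N) v i *: row_cofactor_f i.
Definition comb_g (v : 'I_N -> K) := \sum_(i < N) v i *: row_cofactor_g i.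

Lemma comb_rowE v :
  \sum_(i < N) v i *: row_poly i = comb_f v * f + comb_g v * g.
Proof.
rewrite /comb_f /comb_g !mulr_suml -big_split; apply: eq_bigr => i _.
by rewrite /row_poly scalerDr !scalerAl.
Qed.

Lemma coefz_XnM (p : {poly K}) i j :
  coefz p (i%:Z - j%:Z) = ('X^j * p)`_i.
Proof.
rewrite coefXnM; case: ltnP => lij; last by rewrite subzn.
by have -> : i%:Z - j%:Z = Negz (j - i).-1 by lia.
Qed.

Lemma subres_mxE u v (i j : 'I_N) :
  subres_mx l f g e u v i j =
  if (j < n.*2)%N then (subres_coef_mx i j)%:P
  else if (i < n)%N then u i.+1 else v (i.+1 - n)%N.
Proof.
have ltiN := ltn_ord i.
rewrite !mxE /row_poly /row_cofactor_f /row_cofactor_g.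
case: (ltnP i n) => lin; case: (ltnP j n.*2) => ljn //;
  rewrite mul0r (addr0, add0r) -coefz_XnM; congr (coefz _ _)%:P; lia.
Qed.

(** Deleting the last column leaves only constants, so [Sres] and [Gres] share the same minors. *)
Lemma cofactor_subres_mx u v i :
  cofactor (subres_mx l f g e u v) i ord_max = (subres_minor i)%:P.
Proof.
rewrite /subres_minor -cofactor_map_mx /cofactor; congr (_ * \det _).
apply/matrixP => i' j'; rewrite mxE [LHS]mxE subres_mxE !mxE.
by rewrite lift_max ltn_ord.
Qed.

Lemma det_subres_mx u v :
  \det (subres_mx l f g e u v) =
  \sum_i subres_minor i *: (if (i < n)%N then u i.+1 else v (i.+1 - n)%N).
Proof.
rewrite (expand_det_col _ ord_max); apply: eq_bigr => i _.
by rewrite cofactor_subres_mx subres_mxE ltnn mulrC mul_polyC.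
Qed.

Lemma SresE : Sres l f g e = \sum_i subres_minor i *: row_poly i.
Proof.
rewrite /Sres det_subres_mx; apply: eq_bigr => i _; congr (_ *: _).
rewrite /row_poly /row_cofactor_f /row_cofactor_g.
case: ltnP => lin; rewrite mul0r (addr0, add0r) //; congr ('X^_ * _); lia.
Qed.

Lemma GresE : Gres l f g e = comb_g subres_minor.
Proof.
rewrite /Gres det_subres_mx; apply: eq_bigr => i _; congr (_ *: _).
rewrite /row_cofactor_g; case: ltnP => lin //; congr 'X^_; lia.
Qed.

(** The nonzero cofactors of [f] are distinct monomials, so the coefficients of the combination are
    entries of [v] in reverse order. *)
Lemma coef_comb_f v k :
  (comb_f v)`_k = if (k < n)%N then v (inord (n - k.+1)) else 0.
Proof.
rewrite coef_sum; case: ifP => lkn.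
  rewrite (bigD1 (inord (n - k.+1))) //= big1 ?addr0 => [|i neq_i].
    rewrite /row_cofactor_f inordK; last by lia.
    rewrite coefZ ifT ?coefXn; last by lia.
    by rewrite (_ : _ == _) ?mulr1 //; lia.
  rewrite /row_cofactor_f coefZ; case: ifP => lin; rewrite ?coef0 ?mulr0 //.
  rewrite coefXn; case: eqP => [eq_k|]; rewrite ?mulr0 //.
  by case/eqP: neq_i; apply/val_inj; rewrite /= inordK; lia.
apply: big1 => i _; rewrite /row_cofactor_f coefZ.
case: ifP => lin; rewrite ?coef0 ?mulr0 // coefXn.
by case: eqP => [|_]; rewrite ?mulr0 //; lia.
Qed.

Lemma coef_comb_g v k :
  (comb_g v)`_k = if (k < n.+1)%N then v (inord (n.*2 - k)) else 0.
Proof.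
rewrite coef_sum; case: ifP => lkn.
  rewrite (bigD1 (inord (n.*2 - k))) //= big1 ?addr0 => [|i neq_i].
    rewrite /row_cofactor_g inordK; last by lia.
    rewrite coefZ ifF ?coefXn; last by lia.
    by rewrite (_ : _ == _) ?mulr1 //; lia.
  rewrite /row_cofactor_g coefZ; case: ifP => lin; rewrite ?coef0 ?mulr0 //.
  rewrite coefXn; case: eqP => [eq_k|]; rewrite ?mulr0 //.
  by case/eqP: neq_i; apply/val_inj; rewrite /= inordK; have := ltn_ord i; lia.
apply: big1 => i _; rewrite /row_cofactor_g coefZ.
case: ifP => lin; rewrite ?coef0 ?mulr0 // coefXn.
by case: eqP => [|_]; rewrite ?mulr0 //; have := ltn_ord i; lia.
Qed.

Lemma size_comb_f v : (size (comb_f v) <= n)%N.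
Proof. by apply/leq_sizeP => k lnk; rewrite coef_comb_f ltnNge lnk. Qed.

Lemma size_comb_g v : (size (comb_g v) <= n.+1)%N.
Proof. by apply/leq_sizeP => k lnk; rewrite coef_comb_g ltnNge lnk. Qed.

Lemma comb_surj (u t : {poly K}) : (size u <= n)%N -> (size t <= n.+1)%N ->
  exists v, comb_f v = u /\ comb_g v = t.
Proof.
move=> size_u size_t.
exists (fun i => if (i < n)%N then u`_(n - i.+1) else t`_(n.*2 - i)).
split; apply/polyP => k; rewrite (coef_comb_f, coef_comb_g).
- case: ltnP => lkn; last by rewrite nth_default // (leq_trans size_u).
  by rewrite inordK; [rewrite ifT; [congr (u`_ _)|]|]; lia.
- case: ltnP => lkn; last by rewrite nth_default // (leq_trans size_t).
  by rewrite inordK; [rewrite ifF; [congr (t`_ _)|]|]; lia.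
Qed.

Lemma comb_eq0 v : comb_f v = 0 -> comb_g v = 0 -> forall i, v i = 0.
Proof.
move=> f0 g0 i; have ltiN := ltn_ord i.
case: (ltnP i n) => lin.
  have := coef_comb_f v (n - i.+1); rewrite f0 coef0 ifT; last by lia.
  by move=> ->; congr (v _); apply/val_inj; rewrite /= inordK; lia.
have := coef_comb_g v (n.*2 - i); rewrite g0 coef0 ifT; last by lia.
by move=> ->; congr (v _); apply/val_inj; rewrite /= inordK; lia.
Qed.

Lemma size_comb v :
  (size (comb_f v * f + comb_g v * g)%R <= (l.*2 - e).+1)%N.
Proof.
apply: leq_trans (size_polyD _ _) _; rewrite geq_max; apply/andP; split.
  apply: leq_trans (size_polyMleq _ _) _; rewrite size_f.
  by have := size_comb_f v; lia.
apply: leq_trans (size_polyMleq _ _) _.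
by have := size_comb_g v; move: size_g; lia.
Qed.

(** The linearised interpolation problem: [T] may share factors with [f], so the pairs form a vector
    space. *)
Definition congr_pair (R T : {poly K}) :=
  [/\ (size R <= e.+1)%N, (size T <= n.+1)%N & f %| R - T * g].

(** The product [u * f] has degree at most n + l, so [u] has degree below n and comes from the
    [f]-rows. *)
Lemma congr_pair_comb R T : congr_pair R T ->
  exists v, R = \sum_(i < N) v i *: row_poly i /\ T = comb_g v.
Proof.
case=> size_R size_T /dvdpP[u Ru].
have size_u : (size u <= n)%N.
  have [->|u0] := eqVneq u 0; first by rewrite size_poly0.
  have size_uf : (size (u * f)%R <= (n + l).+1)%N.
    rewrite -Ru (leq_trans (size_polyD _ _)) // size_polyN geq_max.
    rewrite (leq_trans size_R) 1?(leq_trans (size_polyMleq T g)) //; lia.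
  move: size_uf; rewrite size_Mmonic // size_f.
  by move: u0; rewrite -size_poly_gt0; lia.
have [v [vu vT]] := comb_surj size_u size_T.
by exists v; rewrite comb_rowE vu vT -Ru subrK.
Qed.

(** With a zero [g]-part, the combination is a multiple of [f], hence 0 by its degree, which forces
    [v] to vanish. *)
Lemma comb_g_neq0 v : (exists i, v i != 0) ->
  (size (\sum_(i < N) v i *: row_poly i)%R <= l.+1)%N -> comb_g v != 0.
Proof.
case=> i vi0; rewrite comb_rowE; apply: contraTneq => T0.
rewrite T0 mul0r addr0; have [u0|u0] := eqVneq (comb_f v) 0.
  by rewrite (comb_eq0 u0 T0) eqxx in vi0.
by rewrite size_Mmonic // size_f; move: u0; rewrite -size_poly_gt0; lia.
Qed.

Lemma coef_comb_row v (j : 'I_N) :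
  (\sum_(i < N) v i *: row_poly i)`_(l.*2 - e - j) =
  ((\row_i v i) *m subres_coef_mx) 0 j.
Proof. by rewrite coef_sum !mxE; apply: eq_bigr => i _; rewrite coefZ !mxE. Qed.

Lemma size_comb_row v s : (e <= s)%N ->
  (forall j : 'I_N, (s <= l.*2 - e - j)%N ->
     ((\row_i v i) *m subres_coef_mx) 0 j = 0) ->
  (size (\sum_(i < N) v i *: row_poly i)%R <= s)%N.
Proof.
move=> les vQ0; apply/leq_sizeP => k lesk.
case: (ltnP (l.*2 - e) k) => ltk.
  by rewrite nth_default // comb_rowE (leq_trans (size_comb v)).
have ltj : (l.*2 - e - k < N)%N by lia.
have -> : k = (l.*2 - e - Ordinal ltj)%N by rewrite /=; lia.
by rewrite coef_comb_row vQ0 //=; lia.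
Qed.

Lemma comb_congr_pair v : (exists i, v i != 0) ->
  (size (\sum_(i < N) v i *: row_poly i)%R <= e.+1)%N ->
  congr_pair (\sum_(i < N) v i *: row_poly i) (comb_g v) /\ comb_g v != 0.
Proof.
move=> v0 size_v; split; last by apply: comb_g_neq0 => //; lia.
by split=> //; [exact: size_comb_g | rewrite comb_rowE addrK dvdp_mull].
Qed.

Lemma coef_Sres : (Sres l f g e)`_e = \det subres_coef_mx.
Proof.
rewrite (expand_det_col _ ord_max) SresE coef_sum; apply: eq_bigr => i _.
by rewrite coefZ mulrC !mxE; congr (_`_ _ * _); rewrite /=; lia.
Qed.

(** The coefficient is the determinant of the scalar matrix; a left kernel vector also kills the
    column of degree e. *)
Lemma congr_pair_lt : (Sres l f g e)`_e = 0 ->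
  exists R T, [/\ congr_pair R T, T != 0 & (size R <= e)%N].
Proof.
rewrite coef_Sres => /eqP/det0P[v v0 vQ0].
have vE : \row_i v 0 i = v by apply/rowP => i; rewrite mxE.
have size_v : (size (\sum_(i < N) v 0 i *: row_poly i)%R <= e)%N.
  by apply: size_comb_row => // j _; rewrite vE vQ0 mxE.
have [|//|pair_v T0] := @comb_congr_pair (v 0).
- by have /rV0Pn[i vi0] := v0; exists i.
- by rewrite (leq_trans size_v).
by exists (\sum_(i < N) v 0 i *: row_poly i), (comb_g (v 0)); split.
Qed.

(** The minors form the last row of the adjugate, whose product with the matrix is 0 outside the
    last column. *)
Lemma size_Sres : (size (Sres l f g e) <= e.+1)%N.
Proof.
rewrite SresE; apply: size_comb_row => // j ltj.
have -> : \row_i subres_minor i = row ord_max (\adj subres_coef_mx).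
  by apply/rowP => i; rewrite !mxE.
by rewrite -row_mul mul_adj_mx !mxE -val_eqE /= gtn_eqF //; lia.
Qed.

(** If the determinant vanishes, a kernel vector gives the pair; otherwise the minors do, as they
    are not all 0. *)
Lemma congr_pair_ex : exists R T, congr_pair R T /\ T != 0.
Proof.
have [S0|S0] := eqVneq (Sres l f g e)`_e 0.
  by have [R [T [? ? _]]] := congr_pair_lt S0; exists R, T.
have := size_Sres; rewrite SresE => /comb_congr_pair[].
  apply/existsP; apply: contraNT S0; rewrite negb_exists => /forallP w0.
  rewrite SresE big1 ?coef0 // => i _.
  by move: (w0 i); rewrite negbK => /eqP->; rewrite scale0r.
by move=> *; do 2!eexists; split; eassumption.
Qed.

(** Over K[x], the row [v] times the matrix of Sres_e is [R] in the last column and 0 elsewhere;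
    multiplying by the adjugate compares the minors with [v]. *)
Lemma congr_pair_unique R T :
  Sres l f g e != 0 -> congr_pair R T -> T != 0 ->
  exists2 c, c != 0 & Sres l f g e = c *: R /\ Gres l f g e = c *: T.
Proof.
move=> S0 RT T0; have [size_R _ _] := RT.
have [v [Rv Tv]] := congr_pair_comb RT.
pose P := subres_mx l f g e
  (fun r => 'X^(n - r) * f) (fun s => 'X^(n + 1 - s) * g).
have vP : (\row_i (v i)%:P) *m P = R *: delta_mx 0 ord_max.
  apply/rowP => j; rewrite !mxE eqxx /=.
  under eq_bigr do rewrite mxE subres_mxE.
  case: (ltnP j n.*2) => ltj.
    rewrite -val_eqE /= ltn_eqF // mulr0.
    under eq_bigr do rewrite -polyCM; rewrite -rmorph_sum /= -[RHS]polyC0.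
    (* This column holds a degree above e, where [R] has coefficient 0. *)
    have := coef_comb_row v j; rewrite -Rv nth_default; last first.
      by apply: leq_trans size_R _; lia.
    rewrite mxE => vQ0; congr _%:P; rewrite [RHS]vQ0.
    by apply: eq_bigr => i _; rewrite mxE.
  have -> : j == ord_max.
    by apply/eqP/val_inj; have := ltn_ord j; rewrite /=; lia.
  rewrite mulr1 Rv; apply: eq_bigr => i _; rewrite mul_polyC; congr (_ *: _).
  rewrite /row_poly /row_cofactor_f /row_cofactor_g.
  case: ltnP => lin; rewrite mul0r (addr0, add0r) //; congr ('X^_ * _); lia.
have key i : subres_minor i *: R = v i *: Sres l f g e.
  have /rowP/(_ i) : \row_i (v i)%:P *m P *m \adj P = \det P *: \row_i (v i)%:P.
    by rewrite -mulmxA mul_mx_adj mul_mx_scalar.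
  rewrite vP -scalemxAl -rowE !mxE cofactor_subres_mx -/(Sres l f g e).
  by rewrite mulrC mul_polyC mulrC mul_polyC.
have [i vi0] : exists i, v i != 0.
  apply/existsP; apply: contraNT T0; rewrite negb_exists => /forallP v0.
  rewrite Tv /comb_g big1 // => i _.
  by move: (v0 i); rewrite negbK => /eqP->; rewrite scale0r.
pose c := subres_minor i / v i.
have Sc : Sres l f g e = c *: R.
  by rewrite /c mulrC -scalerA key scalerA mulVf ?scale1r.
have R0 : R != 0 by apply: contraNneq S0 => R0; rewrite Sc R0 scaler0.
exists c; first by apply: contraNneq S0 => c0; rewrite Sc c0 scale0r.
(* Cancelling [R] in [key] makes each minor [c] times the entry of [v]. *)
split=> //; rewrite GresE Tv scaler_sumr; apply: eq_bigr => j _.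
rewrite scalerA; congr (_ *: _); apply/eqP; rewrite -subr_eq0.
have := key j; rewrite Sc scalerA => /eqP; rewrite -subr_eq0 -scalerBl.
by rewrite scaler_eq0 (negPf R0) orbF mulrC.
Qed.

End SubresultantCombinations.

(** * Taylor expansions and divisibility by powers of X - c *)

Section TaylorCongruence.

Variable K : fieldType.
Implicit Types (A B p g : {poly K}) (c : K).

(** Translation by [c] reduces this to divisibility by a power of X. *)
Lemma dvdp_XsubCn_taylor p c s :
  reflect (forall j, (j < s)%N -> taylor_coef p c j = 0)
          (('X - c%:P) ^+ s %| p).
Proof.
apply: (iffP idP) => [/dvdpP[q ->] j ltjs | p0].
  rewrite /taylor_coef comp_polyM rmorphXn /= comp_polyB comp_polyX.
  by rewrite comp_polyC addrK coefMXn ltjs.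
have pE : p = (p \Po ('X + c%:P)) \Po ('X - c%:P).
  by rewrite -comp_polyA comp_polyD comp_polyX comp_polyC subrK comp_polyXr.
rewrite pE -[X in X %| _]comp_Xn_poly dvdp_comp_poly //.
apply/dvdpP; exists (drop_poly s (p \Po ('X + c%:P))).
rewrite -[LHS](poly_take_drop s); have -> : take_poly s (p \Po ('X + c%:P)) = 0.
  by apply/polyP => j; rewrite coef_take_poly coef0; case: ifP => // /p0.
by rewrite add0r.
Qed.

(** Either side says that [g] solves u * B = A at [c] up to order [s], a triangular system with
    nonzero diagonal [B.[c]]. *)
Lemma taylor_quot_dvdp A B g c s : B.[c] != 0 ->
  (forall j, (j < s)%N -> taylor_quot A B c j = taylor_coef g c j)
  <-> ('X - c%:P) ^+ s %| A - B * g.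
Proof.
move=> Bc0.
have convE j : taylor_coef (A - B * g) c j = taylor_coef A c j
    - \sum_(i < j.+1) taylor_coef g c i * taylor_coef B c (j - i).
  by rewrite /taylor_coef comp_polyB comp_polyM coefB mulrC coefM.
have [_ /(_ (fun=> erefl)) quotE] :=
  taylor_quotP A (taylor_quot A B c) Bc0.
split=> [eq_AB | /dvdp_XsubCn_taylor AB0].
  apply/dvdp_XsubCn_taylor => j ltjs; rewrite convE -quotE.
  apply/eqP; rewrite subr_eq0; apply/eqP/eq_bigr => i _; rewrite eq_AB //.
  by rewrite (leq_trans _ ltjs) ?ltn_ord.
elim/ltn_ind=> j IHj ltjs; rewrite taylor_quot_rec.
have /eqP := AB0 j ltjs; rewrite convE subr_eq0 => /eqP->.
rewrite big_ord_recr /= subnn taylor_coef0.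
rewrite [X in _ - X](eq_bigr (fun i : 'I_j =>
  taylor_coef g c i * taylor_coef B c (j - i))) => [|i _].
  by rewrite addrC addrK mulfK.
by rewrite IHj // (ltn_trans _ ltjs).
Qed.

End TaylorCongruence.

(** * Gluing the conditions at the nodes into one congruence *)

Lemma dvdp_coprime_prod (K : fieldType) (I : finType) (F : I -> {poly K}) p :
  (forall i j, i != j -> coprimep (F i) (F j)) ->
  (\prod_i F i %| p) = [forall i, F i %| p].
Proof.
move=> coF; rewrite -big_enum.
transitivity (all (fun i => F i %| p) (enum I)); last first.
  by apply/allP/forallP => [Fp i|Fp i _]; rewrite ?Fp ?mem_enum.
elim: (enum I) (enum_uniq I) => [|i r IHr] /=; first by rewrite big_nil dvd1p.
case/andP=> nir /IHr <-; rewrite big_cons Gauss_dvdp //.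
rewrite big_seq; elim/big_rec: _ => [|j q jr coq]; first exact: coprimep1.
by rewrite coprimepMr coq coF //; apply: contraNneq nir => ->.
Qed.

Section Osculatory.

Variables (K : fieldType) (k : nat) (x : 'I_k.+1 -> K) (m : 'I_k.+1 -> nat).
Hypothesis x_inj : injective x.
Hypothesis m_gt0 : forall i, (0 < m i)%N.

Local Notation f := (\prod_(i < k.+1) ('X - (x i)%:P) ^+ m i).

Lemma dvdp_nodes p : (f %| p) = [forall i, ('X - (x i)%:P) ^+ m i %| p].
Proof.
apply: dvdp_coprime_prod => i j neq_ij.
apply/coprimep_expl/coprimep_expr; rewrite coprimep_XsubC root_XsubC.
by rewrite eq_sym (inj_eq x_inj).
Qed.

Lemma coprimep_nodes p : (forall i, p.[x i] != 0) -> coprimep f p.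
Proof.
move=> p0; rewrite coprimep_sym; elim/big_rec: _ => [|i q _ coq].
  exact: coprimep1.
by rewrite coprimepMr coq andbT coprimep_expr // coprimep_XsubC; apply: p0.
Qed.

Lemma osculatory_solutionP y a b l g A B : is_hermite_interp x m y l g ->
  is_osculatory_solution x m y a b A B <->
  [/\ (size A <= a.+1)%N, (size B <= b.+1)%N, forall i, B.[x i] != 0
    & f %| A - B * g].
Proof.
case=> _ gy; split=> [[sA sB B0 ABy] | [sA sB B0 fAB]].
  split=> // [i|]; first exact/B0.
  rewrite dvdp_nodes; apply/forallP => i.
  by apply/(taylor_quot_dvdp _ _ _ (B0 i (m_gt0 i))) => j ltj; rewrite gy ?ABy.
split=> // i j ltj; rewrite -gy //.
move: fAB; rewrite dvdp_nodes => /forallP/(_ i)/(taylor_quot_dvdp _ _ _ (B0 i)).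
exact.
Qed.

End Osculatory.

(** * Cross-multiplication and descent *)

Section CrossMultiplication.

Variables (K : fieldType) (l : nat) (f g : {poly K}).
Hypotheses (f_monic : f \is monic) (size_f : size f = l.+2).
Hypothesis size_g : (size g <= l.+1)%N.

(** Both products are congruent to T T' g modulo [f], and their degrees are below that of [f]. *)
Lemma congr_pair_cross e e' R T R' T' :
  congr_pair l f g e R T -> congr_pair l f g e' R' T' ->
  (size R + size T' <= l.+2)%N -> (size R' + size T <= l.+2)%N ->
  R * T' = R' * T.
Proof.
case=> _ _ fRT [_ _ fRT'] size_RT' size_R'T.
apply/eqP; rewrite -subr_eq0; apply/negPn/negP => cross0.
have : f %| R * T' - R' * T.
  have -> : R * T' - R' * T = T' * (R - T * g) - T * (R' - T' * g) by ring.
  by rewrite dvdp_sub ?dvdp_mull.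
move/(dvdp_leq cross0); rewrite size_f leqNgt ltnS.
rewrite (leq_trans (size_polyD _ _)) // size_polyN geq_max.
by rewrite !(leq_trans (size_polyMleq _ _)) // -subn1 leq_subLR.
Qed.

(* Descent on the degree e of R: if e > d then Sres_e = 0 yields a pair with a
   remainder of smaller degree, and cross-multiplication shows that its
   cofactor is also smaller than T, so that it still is a pair for a. *)
Lemma congr_pair_low a d : (a <= l)%N ->
  (forall e, (d < e <= a)%N -> Sres l f g e = 0) ->
  exists R T, [/\ congr_pair l f g a R T, T != 0 & (size R <= d.+1)%N].
Proof.
move=> le_al Sres0.
have [R [T [RT T0]]] := congr_pair_ex f_monic size_f size_g le_al.
have [s] := ubnP (size R); elim: s => // s IHs in R T RT T0 *.
rewrite ltnS => size_Rs; case: (leqP (size R) d.+1) => [|lt_dR].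
  by exists R, T.
have [size_R size_T fRT] := RT.
have [e size_Re] : exists e, size R = e.+1 by exists (size R).-1; lia.
have le_el : (e <= l)%N by lia.
have [|R' [T' [RT' T'0 size_R']]] :=
    @congr_pair_lt K l f g e f_monic size_f size_g le_el.
  by rewrite Sres0 ?coef0 //; lia.
have [_ size_T' fRT'] := RT'.
have cross : R * T' = R' * T.
  by apply: (congr_pair_cross RT RT'); lia.
have R0 : R != 0 by rewrite -size_poly_gt0; lia.
have R'0 : R' != 0.
  apply: contraTneq (mulf_neq0 R0 T'0) => R'0.
  by rewrite cross R'0 mul0r eqxx.
have size_cross : ((size R + size T').-1 = (size R' + size T).-1)%N.
  by rewrite -!size_mul ?cross.
apply: (IHs R' T') => //; last by lia.
split=> //; first by lia.
have : (0 < size T)%N by rewrite size_poly_gt0.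
by lia.
Qed.

End CrossMultiplication.

(** * Solutions compared with the subresultant pair *)

Theorem theorem2p2 (K : fieldType) (a b k : nat)
    (x : 'I_k.+1 -> K) (m : 'I_k.+1 -> nat) (y : 'I_k.+1 -> nat -> K)
    (x_inj : injective x)
    (m_gt0 : forall i, (0 < m i)%N)
    (m_sum : (\sum_(i < k.+1) m i)%N = (a + b).+1)
    (f g : {poly K})
    (f_def : f = \prod_(i < k.+1) ('X - (x i)%:P) ^+ m i)
    (g_def : is_hermite_interp x m y (a + b) g)
    (d : nat)
    (d_le : (d <= a)%N)
    (d_neq0 : Sres (a + b) f g d != 0)
    (d_max : forall e, (d < e <= a)%N -> Sres (a + b) f g e = 0) :
  let S := Sres (a + b) f g d in
  let G := Gres (a + b) f g d in
  [/\ (size G <= b.+1)%N,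
      (exists A B : {poly K}, is_osculatory_solution x m y a b A B)
        <-> (forall i, G.[x i] != 0)
    & (exists A B : {poly K}, is_osculatory_solution x m y a b A B) ->
      [/\ is_osculatory_solution x m y a b S G,
          (forall A B : {poly K}, is_osculatory_solution x m y a b A B ->
             tofrac A / tofrac B = tofrac S / tofrac G :> {fraction {poly K}})
        & coprimep S G]].
Proof.
move=> S G; set l := (a + b)%N in d_neq0 d_max S G *.
have [size_g gy] := g_def.
have f_monic : f \is monic.
  by rewrite f_def; apply: monic_prod => i _; rewrite monic_exp ?monicXsubC.
have size_f : size f = l.+2.
  rewrite f_def size_prod_seq => [|i _]; last first.
    by rewrite expf_neq0 ?polyXsubC_eq0.
  under eq_bigr do rewrite size_exp_XsubC -addn1.
  by rewrite big_split /= m_sum sum1_size; lia.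
have le_al : (a <= l)%N by rewrite leq_addr.
have le_dl : (d <= l)%N by apply: leq_trans le_al.
have [R [T [RT T0 size_R]]] :=
  congr_pair_low f_monic size_f size_g le_al d_max.
have [_ size_T fRT] := RT.
(* The bound l - a = b on deg [T], which later bounds deg [G], is at most l - d. *)
have RTd : congr_pair l f g d R T by split=> //; lia.
have [c c0 [SR GT]] :=
  congr_pair_unique f_monic size_f size_g le_dl d_neq0 RTd T0.
have size_S : (size S <= d.+1)%N by rewrite /S SR size_scale.
have size_G : (size G <= b.+1)%N by rewrite /G GT size_scale // -(addKn a b).
have G0 : G != 0 by rewrite /G GT scaler_eq0 negb_or c0.
have fSG : f %| S - G * g.
  by rewrite /S /G SR GT -scalerAl -scalerBr dvdpZr.
have solP A B := osculatory_solutionP x_inj m_gt0 a b A B g_def.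
rewrite -f_def in solP.
have pair_SG : congr_pair l f g d S G.
  by split=> //; apply: leq_trans size_G _; rewrite /l; lia.
have sol_cross A B : is_osculatory_solution x m y a b A B -> A * G = S * B.
  case/solP=> size_A size_B _ fAB.
  have pair_AB : congr_pair l f g a A B by split=> //; lia.
  by apply: (congr_pair_cross size_f pair_AB pair_SG);
    lia.
have sol_imp A B : is_osculatory_solution x m y a b A B ->
    (forall i, G.[x i] != 0) /\ coprimep S G.
  move=> solAB; have cross := sol_cross _ _ solAB.
  case/solP: solAB => size_A size_B B0 fAB.
  pose q := gcdp S G; pose S' := S %/ q; pose G' := G %/ q.
  have Sq : S = S' * q by rewrite divpK ?dvdp_gcdl.
  have Gq : G = G' * q by rewrite divpK ?dvdp_gcdr.
  have q0 : q != 0 by rewrite gcdp_eq0 negb_and d_neq0.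
  have G'0 : G' != 0 by apply: contraNneq G0 => G'0; rewrite Gq G'0 mul0r.
  have coS'G' : coprimep S' G' by rewrite coprimep_div_gcd ?d_neq0.
  have cross' : A * G' = S' * B.
    by apply: (mulIf q0); rewrite -mulrA -Gq cross Sq mulrAC.
  (* [G'] divides [S' * B] and is coprime to [S']. *)
  have /dvdpP[t Bt] : G' %| B.
    rewrite -(Gauss_dvdpr _ (_ : coprimep G' S')) 1?coprimep_sym //.
    by rewrite -cross' dvdp_mull.
  have At : A = t * S' by apply: (mulIf G'0); rewrite cross' Bt; ring.
  have t0 i : t.[x i] != 0.
    by apply: contraNneq (B0 i) => t0; rewrite Bt hornerM t0 mul0r.
  have G'x i : G'.[x i] != 0.
    by apply: contraNneq (B0 i) => G'x; rewrite Bt hornerM G'x mulr0.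
  (* [A - B * g] is [t] times this polynomial, and [t] vanishes at no node. *)
  have fS'G' : f %| S' - G' * g.
    have cotf : coprimep f t by rewrite f_def coprimep_nodes.
    by rewrite -(Gauss_dvdpr _ cotf) mulrBr mulrA -At -Bt.
  have pair' : congr_pair l f g d S' G'.
    split=> //.
      by apply: leq_trans size_S; rewrite leq_divp.
    by have [_ + _] := pair_SG; apply: leq_trans; rewrite leq_divp.
  (* Uniqueness makes the reduced pair proportional to ([S], [G]), so nonvanishing and coprimality
     carry over. *)
  have [c' c'0 [SS' GG']] :=
    congr_pair_unique f_monic size_f size_g le_dl d_neq0 pair' G'0.
  rewrite -/S -/G in SS' GG'.
  split=> [i|]; first by rewrite GG' hornerZ mulf_neq0.
  by rewrite SS' GG' coprimepZl ?coprimepZr.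
have solSG : (forall i, G.[x i] != 0) -> is_osculatory_solution x m y a b S G.
  by move=> Gx; apply/solP; split=> //; apply: leq_trans size_S _.
split=> //; first split.
- by case=> A [B /sol_imp[]].
- by move=> /solSG ?; exists S, G.
case=> A0 [B0 /sol_imp[Gx coSG]]; split=> // [|A B solAB]; first exact: solSG.
have B0' : B != 0.
  case/solP: solAB => _ _ /(_ ord0) + _.
  by apply: contraNneq => ->; rewrite horner0.
apply/eqP; rewrite eqr_div ?tofrac_eq0 // -!tofracM tofrac_eq.
by rewrite (sol_cross _ _ solAB).
Qed.
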